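(* Let $e\ge3$ be an odd integer, let $\mathfrak{X}=(\mathcal{R},\{R_j\}_{j=0}^6)$ be the association scheme on the Galois ring $\mathcal{R}$ described in the context, and let $A_0,\dots,A_6$ be the adjacency matrices of $R_0,\dots,R_6$. Let $w_0=1$ and let $w_1,\dots,w_6$ be complex numbers of absolute value $1$. Put $W=\sum_{j=0}^6 w_jA_j$ and assume that $W$ is hermitian. Then $W$ is a complex Hadamard matrix if and only if \[ W=A_0+\epsilon_1 i(A_1-A_2)+\epsilon_2 i(A_3-A_4)+A_5+A_6 \quad\text{or}\quad W=A_0+\epsilon_1 i(A_1-A_2)+\epsilon_2(A_3+A_4)+A_5-A_6 \] for some $\epsilon_1,\epsilon_2\in\{\pm1\}$, where $i^2=-1$.
   Context: Let $e\ge 3$ be odd, $F=\mathrm{GF}(2)$, $K=\mathrm{GF}(2^e)=F[x]/(\varphi(x))$ with $\varphi$ a primitive polynomial of degree $e$ over $F$ and $\zeta$ a root of $\varphi$ in $K$; $\mathrm{Tr}:K\to F$ is the absolute trace. Let $\mathcal{A}=\mathbb{Z}/4\mathbb{Z}$ and let $\Phi(x)\in\mathcal{A}[x]$ be monic with $\Phi\equiv\varphi \pmod{2\mathcal{A}[x]}$ and $\Phi$ dividing $x^{2^e-1}-1$ in $\mathcal{A}[x]$. The Galois ring is $\mathcal{R}=\mathcal{A}[x]/(\Phi(x))$, local with maximal ideal $\mathcal{P}=2\mathcal{R}$ and $\mathcal{R}/\mathcal{P}\cong K$, with the image $\xi$ of $x$ mapped to $\zeta$. Let $\mathcal{T}=\langle\xi\rangle$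 (cyclic of order $2^e-1$), $\mathcal{T}_0=\{\xi^j: 0\le j\le 2^e-2,\ \mathrm{Tr}(\zeta^j)=0\}$, $\mathcal{P}_0=2\mathcal{T}_0\cup\{0\}$ and $H=1+\mathcal{P}_0$. Let $S_0=\{0\}$, $S_1=(\mathcal{T}\setminus\{1\})H$, $S_2=(\mathcal{T}\setminus\{1\})(-H)$, $S_3=H$, $S_4=-H$, $S_5=\mathcal{P}_0\setminus\{0\}$, $S_6=\mathcal{P}\setminus\mathcal{P}_0$ (set products $AB=\{ab:a\in A,b\in B\}$), and $R_j=\{(\alpha,\beta)\in\mathcal{R}\times\mathcal{R}:\alpha-\beta\in S_j\}$. Then $\mathfrak{X}=(\mathcal{R},\{R_j\}_{j=0}^6)$ is a commutative association scheme with $A_1^\top=A_2$, $A_3^\top=A_4$, $A_5,A_6$ symmetric. A complex Hadamard matrix of order $n$ is an $n\times n$ matrix $W$ with all entries of absolute value $1$ and $W\overline{W}^\top=nI$. *)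

(* Defs.v *)
From HB Require Import structures.
From mathcomp Require Import all_boot all_order all_fingroup all_algebra all_field.

Set Implicit Arguments.
Unset Strict Implicit.
Unset Printing Implicit Defensive.

Import Order.TTheory GRing.Theory Num.Theory.
Local Open Scope ring_scope.
Local Open Scope sesquilinear_scope.

Section Residue_field.

Variables (phi : {poly 'F_2}) (phi_prim : primitive_poly phi).

Definition residue_field : splittingFieldType 'F_2 :=
  qfpoly_splitting_field_type (primitive_mi phi_prim).

Definition zeta : residue_field := 'qX : {poly %/ phi}.

(* Valued in the prime subfield of [residue_field] rather than in ['F_2]. *)
Definition absolute_trace (a : residue_field) : residue_field :=
  galTrace 1%VS {:residue_field}%VS a.

End Residue_field.

Definition Z4_to_F2 (a : 'Z_4) : 'F_2 := (a : nat)%:R.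

Section Galois_ring_scheme.

Variables (e : nat) (phi : {poly 'F_2}) (phi_prim : primitive_poly phi).
Variable Phi : {poly 'Z_4}.

Definition galois_ring : predArgType := {poly %/ Phi}.
HB.instance Definition _ := GRing.ComNzRing.on galois_ring.
HB.instance Definition _ := Finite.on galois_ring.

Definition xi : galois_ring := 'qX.

Definition mulset (A B : {set galois_ring}) : {set galois_ring} :=
  [set a * b | a in A, b in B].
Definition oppset (A : {set galois_ring}) : {set galois_ring} :=
  [set - a | a in A].

(* The exponents run over [0 .. 2 ^ e - 2]; this is the group generated by [xi]
   as soon as [Phi] divides ['X^(2 ^ e - 1) - 1]. *)
Definition teich : {set galois_ring} :=
  [set xi ^+ (j : nat) | j : 'I_(2 ^ e - 1)].

Definition teich0 : {set galois_ring} :=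
  [set xi ^+ (j : nat) | j : 'I_(2 ^ e - 1) &
     absolute_trace (zeta phi_prim ^+ (j : nat)) == 0].

Definition maxideal : {set galois_ring} := [set 2 * a | a : galois_ring].

Definition maxideal0 : {set galois_ring} := [set 2 * t | t in teich0] :|: [set 0].

Definition subgroupH : {set galois_ring} := [set 1 + p | p in maxideal0].

Definition scheme_set (j : 'I_7) : {set galois_ring} :=
  tnth [tuple [set 0];
              mulset (teich :\ 1) subgroupH;
              mulset (teich :\ 1) (oppset subgroupH);
              subgroupH;
              oppset subgroupH;
              maxideal0 :\ 0;
              maxideal :\: maxideal0] j.

Definition scheme_rel (j : 'I_7) : {set galois_ring * galois_ring} :=
  [set ab | ab.1 - ab.2 \in scheme_set j].

End Galois_ring_scheme.

(* Rows and columns are indexed by [T] through its canonical enumeration. *)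
Definition adjacency_mx (C : nzRingType) (T : finType) (r : {set T * T}) :
    'M[C]_#|T| :=
  \matrix_(i, j) ((enum_val i, enum_val j) \in r)%:R.

Definition scheme_mx (C : nzRingType) (e : nat) (phi : {poly 'F_2})
    (phi_prim : primitive_poly phi) (Phi : {poly 'Z_4}) (j : 'I_7) :
    'M[C]_#|galois_ring Phi| :=
  adjacency_mx C (scheme_rel e phi_prim Phi j).

Definition complex_hadamard (C : numClosedFieldType) (n : nat) (W : 'M[C]_n) :
    Prop :=
  (forall i j, `|W i j| = 1) /\ W *m W^t* = n%:R%:M.

(* Main.v *)
From HB Require Import structures.
Require Import Defs.
From mathcomp Require Import all_boot all_order all_fingroup all_algebra all_field.
From mathcomp Require Import complex ring.
From mathcomp Require Import reals.

(** [W] is the Cayley matrix of a function [f] on the additive group of the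
    Galois ring, so it is diagonalised by the additive characters; as [W] is
    hermitian, it is Hadamard iff every eigenvalue squares to [4 ^ e].
    Write [x = tau k + 2 tau s] with [tau] the Teichmuller lift.  On each coset
    of the maximal ideal ([k] fixed) [f] is affine in one character of [s],
    namely [(-1) ^ Tr (s / k)] for [k <> 0], so each eigenvalue collapses to few
    terms.  All that is used of the additive character [psi] generating the
    others is [psi (2 x) = (-1) ^ Tr x]; as [e] is odd, [Tr 1 = 1] and hence
    [psi 1 ^ 2 = -1].
    The characters [b] with [b mod 2] outside {0, 1} force [w_5 = 1] and
    [w_1 = - w_2 = +-i]; those with [b mod 2 = 0] then leave the two
    families. *)

Set Implicit Arguments.
Unset Strict Implicit.
Unset Printing Implicit Defensive.

Import Order.TTheory GRing.Theory Num.Theory.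
Local Open Scope ring_scope.

(** * Cayley matrices and the Fourier transform *)

Section FourierTransform.

Variables (R : finComNzRingType) (C : numClosedFieldType) (psi : R -> C).
Hypothesis psi0 : psi 0 = 1.
Hypothesis psiD : forall x y, psi (x + y) = psi x * psi y.
Hypothesis psi_nondeg : forall x, x != 0 -> exists b, psi (b * x) != 1.

Definition fourier (f : R -> C) (b : R) : C := \sum_x f x * psi (b * x).

Definition cayley_mx (f : R -> C) : 'M[C]_#|R| :=
  \matrix_(i, j) f (enum_val i - enum_val j).

Definition character_mx : 'M[C]_#|R| :=
  \matrix_(i, j) psi (enum_val j * enum_val i).

Definition character_inv_mx : 'M[C]_#|R| :=
  \matrix_(i, j) psi (- enum_val i * enum_val j).

(** Translating the summation index by [b] multiplies the sum by [psi (b * x)], and non-degeneracy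
    supplies a [b] for which this factor is not 1. *)
Lemma sum_character x : \sum_b psi (b * x) = #|R|%:R * (x == 0)%:R.
Proof.
have [->|/psi_nondeg[b nb]] := eqVneq x 0.
  by under eq_bigr do rewrite mulr0 psi0; rewrite sumr_const mulr1.
rewrite mulr0; apply: (mulIf (x := psi (b * x) - 1)); first by rewrite subr_eq0.
rewrite mul0r mulrBr mulr1 mulr_suml [X in _ - X](reindex_inj (addIr b)) /=.
by under [X in _ - X]eq_bigr do rewrite mulrDl psiD; rewrite subrr.
Qed.

Lemma sum_enum_val (F : R -> C) : \sum_(i < #|R|) F (enum_val i) = \sum_x F x.
Proof. by rewrite -(@big_enum_val _ _ _ _ R); apply: eq_bigl. Qed.

Lemma card_ring_neq0 : #|R|%:R != 0 :> C.
Proof. by rewrite pnatr_eq0 -lt0n; apply/card_gt0P; exists 0. Qed.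

Lemma mul_character_inv : character_mx *m character_inv_mx = #|R|%:R%:M.
Proof.
apply/matrixP => i j; rewrite !mxE.
under eq_bigr do rewrite !mxE -psiD mulNr -mulrBr.
rewrite (sum_enum_val (fun b => psi (b * _))) sum_character subr_eq0.
by rewrite (inj_eq enum_val_inj) mulr_natr.
Qed.

Lemma mul_inv_character : character_inv_mx *m character_mx = #|R|%:R%:M.
Proof.
apply/matrixP => i j; rewrite !mxE.
under eq_bigr do rewrite !mxE -psiD -mulrDl mulrC.
rewrite (sum_enum_val (fun b => psi (b * _))) sum_character addrC subr_eq0.
by rewrite (inj_eq enum_val_inj) eq_sym mulr_natr.
Qed.

(** Each column of [character_mx] is an eigenvector: substituting [c = i - x] in the convolution
    splits off [psi (j * i)] and leaves [psi (- j * x)], hence the transform at the opposite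
    point. *)
Lemma cayley_mul_character f :
  cayley_mx f *m character_mx =
  character_mx *m diag_mx (\row_i fourier f (- enum_val i)).
Proof.
apply/matrixP => i j; rewrite mul_mx_diag !mxE.
under eq_bigr do rewrite !mxE.
rewrite (sum_enum_val (fun c => f (_ - c) * psi (_ * c))) mulr_sumr.
rewrite (reindex_inj (inv_inj (subKr (enum_val i)))) /=.
apply: eq_bigr => x _; rewrite subKr mulrCA -psiD; congr (_ * psi _).
by rewrite mulNr mulrBr.
Qed.

(** As [character_mx] is invertible up to the nonzero scalar [#|R|], the matrix identity can be read
    on the diagonal form. *)
Lemma cayley_sqr f :
  cayley_mx f *m cayley_mx f = #|R|%:R%:M <->
  forall b, fourier f b ^+ 2 = #|R|%:R.
Proof.
pose d : 'rV[C]_#|R| := \row_i fourier f (- enum_val i).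
have VD : cayley_mx f *m cayley_mx f *m character_mx =
          character_mx *m diag_mx (\row_i (d 0 i ^+ 2)).
  rewrite -mulmxA cayley_mul_character mulmxA cayley_mul_character -mulmxA.
  by rewrite mulmx_diag; congr (_ *m diag_mx _); apply/rowP => i; rewrite !mxE.
split=> [W2 b | H].
  move: VD; rewrite W2 mul_scalar_mx => /(congr1 (mulmx character_inv_mx)).
  rewrite -scalemxAr mulmxA mul_inv_character mul_scalar_mx.
  move/(scalerI card_ring_neq0).
  move/matrixP/(_ (enum_rank (- b)) (enum_rank (- b))).
  by rewrite !mxE eqxx enum_rankK opprK !mulr1n => <-.
have {}H : \row_i (d 0 i ^+ 2) = const_mx #|R|%:R :> 'rV[C]_#|R|.
  by apply/rowP => i; rewrite !mxE H.
move: VD; rewrite H diag_const_mx mul_mx_scalar.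
move=> /(congr1 (mulmxr character_inv_mx)).
rewrite /= -mulmxA mul_character_inv mul_mx_scalar -scalemxAl mul_character_inv.
by move/(scalerI card_ring_neq0).
Qed.

End FourierTransform.

(** * The spectrum in Teichmuller coordinates *)

Section TeichmullerCoordinates.

Variables (K : finFieldType) (R : finComNzRingType) (C : numClosedFieldType).
Variables (rho : {rmorphism R -> K}) (tau : K -> R).
Variables (tr : K -> bool) (psi : R -> C).

Hypothesis rho_ker : forall a, rho a = 0 -> exists b, a = 2 * b.
Hypothesis mul2_eq0 : forall a, (2 * a == 0) = (rho a == 0).
Hypothesis tau0 : tau 0 = 0.
Hypothesis tau1 : tau 1 = 1.
Hypothesis tauM : forall k l, tau (k * l) = tau k * tau l.
Hypothesis tauK : forall k, rho (tau k) = k.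
Hypothesis trD : forall k l, tr (k + l) = tr k (+) tr l.
Hypothesis tr1 : tr 1.
Hypothesis psi0 : psi 0 = 1.
Hypothesis psiD : forall x y, psi (x + y) = psi x * psi y.

Definition sign_tr (k : K) : C := (-1) ^+ tr k.
Local Notation chi := sign_tr.

Hypothesis psi2 : forall x, psi (2 * x) = chi (rho x).

Lemma tr0 : tr 0 = false.
Proof. by have := trD 0 0; rewrite addr0; case: (tr 0). Qed.

Lemma sign_tr0 : chi 0 = 1.
Proof. by rewrite /chi tr0. Qed.

Lemma sign_tr1 : chi 1 = -1.
Proof. by rewrite /chi tr1 expr1. Qed.

Lemma sign_trD k l : chi (k + l) = chi k * chi l.
Proof. by rewrite /chi trD signr_addb. Qed.

Lemma sqr_sign_tr k : chi k ^+ 2 = 1.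
Proof. by rewrite /chi sqrr_sign. Qed.

(** If 2 were invertible, [1 = 2^-1 + 2^-1] would have trace 0, against [tr1]. *)
Lemma addrr_char2 (k : K) : k + k = 0.
Proof.
apply/eqP; rewrite -mulr2n -mulr_natr mulf_eq0; apply/orP; right.
apply: contraTT tr1 => nz2; rewrite -(divff nz2) mulr_natl mulr2n trD.
by rewrite addbb.
Qed.

Lemma addr_eq0_char2 (k l : K) : (k + l == 0) = (k == l).
Proof. by rewrite -[RHS](inj_eq (addIr l)) addrr_char2. Qed.

Lemma rho2 : rho 2 = 0.
Proof. by rewrite rmorph_nat mulr2n addrr_char2. Qed.

Lemma mul2_rho a b : rho a = rho b -> 2 * a = 2 * b.
Proof.
by move=> ab; apply/eqP; rewrite -subr_eq0 -mulrBr mul2_eq0 rmorphB ab subrr.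
Qed.

Lemma mul22 : 2 * 2 = 0 :> R.
Proof. by apply/eqP; rewrite mul2_eq0 rho2. Qed.

Definition teich_pair (k s : K) : R := tau k + 2 * tau s.

(** The default 0 is never reached: by [teich_pairP] the search always succeeds. *)
Definition snd_digit (x : R) : K :=
  odflt 0 [pick s | x == teich_pair (rho x) s].

Lemma rho_teich_pair k s : rho (teich_pair k s) = k.
Proof. by rewrite rmorphD rmorphM rho2 mul0r addr0 tauK. Qed.

Lemma teich_pair_inj k s k' s' :
  teich_pair k s = teich_pair k' s' -> k = k' /\ s = s'.
Proof.
move=> e; have := congr1 rho e; rewrite !rho_teich_pair => kk; subst k'.
split=> //; move: e => /addrI /eqP.
by rewrite -subr_eq0 -mulrBr mul2_eq0 rmorphB !tauK subr_eq0 => /eqP.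
Qed.

Lemma teich_pairP x : x = teich_pair (rho x) (snd_digit x).
Proof.
rewrite /snd_digit; case: pickP => [s /eqP //|/= none].
have [|b xb] := @rho_ker (x - tau (rho x)); first by rewrite rmorphB tauK subrr.
have := none (rho b); rewrite /teich_pair -(@mul2_rho b) ?tauK // -xb.
by rewrite addrC subrK eqxx.
Qed.

Lemma snd_digitE k s : snd_digit (teich_pair k s) = s.
Proof. by have /teich_pair_inj[_ <-] := teich_pairP (teich_pair k s). Qed.

Lemma sum_teich_pair (F : R -> C) :
  \sum_x F x = \sum_k \sum_s F (teich_pair k s).
Proof.
rewrite pair_bigA (reindex (fun p : K * K => teich_pair p.1 p.2)) //=.
apply/onW_bij; exists (fun x => (rho x, snd_digit x)) => [[k s]|x] /=.
  by rewrite rho_teich_pair snd_digitE.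
by rewrite -teich_pairP.
Qed.

Lemma card_galois_ring : #|R|%:R = #|K|%:R ^+ 2 :> C.
Proof.
have := sum_teich_pair (fun=> 1); rewrite !sumr_const => ->.
by rewrite -[LHS]mulr_natr expr2.
Qed.

(** The factor [b] makes [b * x] twice an element reducing to 1, where [psi] is -1. If [x] has
    nonzero reduction, the 2 is put into [b]; otherwise [x = 2 * y] brings it. *)
Lemma character_nondeg x : x != 0 -> exists b, psi (b * x) != 1.
Proof.
move=> nzx.
have minus1 : (-1 : C) != 1.
  by rewrite eq_sym -subr_eq0 opprK (pnatr_eq0 C 2).
have [rx0|nzrx] := eqVneq (rho x) 0; last first.
  exists (2 * tau (rho x)^-1).
  by rewrite -mulrA psi2 rmorphM tauK mulVf // sign_tr1.
have [y xy] := rho_ker rx0; move: nzx; rewrite xy mul2_eq0 => nzy.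
exists (tau (rho y)^-1).
by rewrite mulrCA psi2 rmorphM tauK mulVf // sign_tr1.
Qed.

Lemma psi1_sqr : psi 1 ^+ 2 = -1.
Proof. by rewrite expr2 -psiD -[1 + 1]mulr1 psi2 rmorph1 sign_tr1. Qed.

Lemma sum_sign_tr l : \sum_s chi (l * s) = #|K|%:R *+ (l == 0).
Proof.
have [->|nz] := eqVneq l 0.
  by under eq_bigr do rewrite mul0r sign_tr0; rewrite sumr_const.
apply/eqP; set S := (X in X == _); rewrite mulr0n.
(* Shifting the index by [l^-1] multiplies every term by [chi 1 = -1]. *)
have : S = - S.
  rewrite {1}/S (reindex_inj (addIr l^-1)) /= -sumrN.
  by apply: eq_bigr => s _; rewrite mulrDr divff // sign_trD sign_tr1 mulrN1.
by move/eqP; rewrite -addr_eq0 -mulr2n mulrn_eq0.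
Qed.

Lemma psi_teich_pair l m k s :
  psi (teich_pair l m * teich_pair k s) =
  psi (tau (l * k)) * chi (m * k) * chi (l * s).
Proof.
have -> : teich_pair l m * teich_pair k s =
    tau (l * k) + 2 * (tau m * tau k + tau l * tau s) + 2 * 2 * (tau m * tau s).
  by rewrite /teich_pair tauM; ring.
by rewrite mul22 mul0r addr0 psiD psi2 rmorphD !rmorphM !tauK sign_trD mulrA.
Qed.

(** The index of the class of [tau k + 2 * tau s], as [mem_scheme_set] confirms. For [k != 0],
    dividing by [tau k] leaves [1 + 2 * tau (s / k)], which lies in [H] or [-H] according to the
    trace of [s / k]. *)
Definition color (k s : K) : 'I_7 :=
  if k == 0 then if s == 0 then 0 else if tr s then 6 else 5
  else if k == 1 then if tr s then 4 else 3
  else if tr (k^-1 * s) then 2 else 1.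

Definition ring_color (x : R) : 'I_7 := color (rho x) (snd_digit x).

Lemma ring_color_pair k s : ring_color (teich_pair k s) = color k s.
Proof. by rewrite /ring_color rho_teich_pair snd_digitE. Qed.

(** Here [- tau k = tau k - 2 * tau k], and twice an element depends only on its reduction, where
    signs disappear. *)
Lemma opp_teich_pair k s : - teich_pair k s = teich_pair k (k + s).
Proof.
have -> : - teich_pair k s = tau k + 2 * (- tau k - tau s).
  by rewrite /teich_pair; ring.
congr (_ + _); apply: mul2_rho; rewrite rmorphB rmorphN !tauK.
by apply/eqP; rewrite -addr_eq0_char2; apply/eqP; rewrite addrCA; ring.
Qed.

(** * Fourier coefficients of a weight function on the classes *)

Section Weights.

Variable w : 'I_7 -> C.

(* On the coset [tau k + 2 R] the weights are affine in the additive character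
   [s |-> chi (slope k * s)], except for the extra value at [x = 0]. *)
Definition mean_weight (k : K) : C :=
  if k == 0 then (w 5 + w 6) / 2
  else if k == 1 then (w 3 + w 4) / 2 else (w 1 + w 2) / 2.

Definition diff_weight (k : K) : C :=
  if k == 0 then (w 5 - w 6) / 2
  else if k == 1 then (w 3 - w 4) / 2 else (w 1 - w 2) / 2.

Definition slope (k : K) : K := if k == 0 then 1 else k^-1.

Lemma weight_color k s :
  w (color k s) = mean_weight k + diff_weight k * chi (slope k * s)
                  + (w 0 - w 5) *+ ((k == 0) && (s == 0)).
Proof.
rewrite /color /mean_weight /diff_weight /slope /chi.
case: (eqVneq k 0) => [_|_].
  rewrite mul1r; have [->|_] := eqVneq s 0.
    by rewrite tr0 /= expr0; field.
  by case: (tr s); rewrite /= ?expr0 ?expr1 addr0; field.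
case: (eqVneq k 1) => [->|_].
  by rewrite invr1 mul1r; case: (tr s); rewrite /= ?expr0 ?expr1 addr0; field.
by case: (tr _); rewrite /= ?expr0 ?expr1 addr0; field.
Qed.

Local Notation hat := (fourier psi (w \o ring_color)).

(** By orthogonality in [s], the mean survives only for [l = 0] and the other part only for
    [l = slope k]. The exceptional value at [x = 0] adds [w 0 - w 5] to every coefficient. *)
Lemma fourier_color l m :
  hat (teich_pair l m) = w 0 - w 5 + #|K|%:R *
    \sum_k psi (tau (l * k)) * chi (m * k) *
      (mean_weight k *+ (l == 0) + diff_weight k *+ (l == slope k)).
Proof.
rewrite /fourier sum_teich_pair mulr_sumr.
have -> : w 0 - w 5 = \sum_(k : K) (w 0 - w 5) *+ (k == 0).
  by rewrite (bigD1 0) //= eqxx big1 ?addr0 // => k /negPf->.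
rewrite -big_split /=; apply: eq_bigr => k _.
under eq_bigr do rewrite /= ring_color_pair weight_color psi_teich_pair.
transitivity (psi (tau (l * k)) * chi (m * k) *
   (mean_weight k * \sum_s chi (l * s)
    + diff_weight k * \sum_s chi ((l + slope k) * s)
    + \sum_(s : K) (w 0 - w 5) *+ ((k == 0) && (s == 0)))).
  rewrite !mulr_sumr -!big_split /= mulr_sumr; apply: eq_bigr => s _.
  rewrite [(l + _) * s]mulrDl sign_trD; have [->|nzs] := eqVneq s 0.
    by rewrite !mulr0 sign_tr0; ring.
  by rewrite andbF mulr0n; ring.
rewrite !sum_sign_tr addr_eq0_char2.
have -> : \sum_(s : K) (w 0 - w 5) *+ ((k == 0) && (s == 0)) =
          (w 0 - w 5) *+ (k == 0).
  rewrite (bigD1 0) //= eqxx andbT big1 ?addr0 // => s /negPf->.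
  by rewrite andbF.
have [->|nzk] := eqVneq k 0.
  rewrite !mulr0 tau0 psi0 sign_tr0.
  by case: (l == 0); case: (l == _); rewrite ?mulr0n ?mulr1n; ring.
by case: (l == 0); case: (l == _); rewrite ?mulr0n ?mulr1n; ring.
Qed.

Lemma slope_neq0 k : slope k != 0.
Proof.
by rewrite /slope; have [_|nz] := eqVneq k 0; rewrite ?oner_eq0 ?invr_eq0.
Qed.

(** Only the coset [k = l^-1] has slope [l]. *)
Lemma fourier_teich l m : l != 0 -> l != 1 ->
  hat (teich_pair l m) =
  w 0 - w 5 + #|K|%:R * (psi 1 * chi (m / l) * ((w 1 - w 2) / 2)).
Proof.
move=> nz0 nz1; rewrite fourier_color (bigD1 l^-1) //= big1 ?addr0 => [|k nk].
  rewrite (negPf nz0) /slope /diff_weight invr_eq0 (negPf nz0) invrK eqxx.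
  by rewrite invr_eq1 (negPf nz1) add0r divff // tau1.
rewrite (negPf nz0) /slope add0r.
have [_|nzk] := eqVneq k 0; first by rewrite (negPf nz1) mulr0.
by rewrite eq_sym (can2_eq invrK invrK) (negPf nk) mulr0.
Qed.

(** Slope 1 occurs on exactly two cosets, [k = 0] and [k = 1]. *)
Lemma fourier_teich1 m :
  hat (teich_pair 1 m) =
  w 0 - w 5 + #|K|%:R * ((w 5 - w 6) / 2 + psi 1 * chi m * ((w 3 - w 4) / 2)).
Proof.
have n10 := oner_neq0 K.
rewrite fourier_color (bigD1 0) //= (bigD1 1) //= big1 => [|k /andP[n0 n1]].
  have -> : slope 0 = 1 by rewrite /slope eqxx.
  have -> : slope 1 = 1 by rewrite /slope (negPf n10) invr1.
  rewrite /diff_weight !eqxx (negPf n10) !mulr0 !mulr1 tau0 tau1 psi0 sign_tr0.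
  by rewrite !mulr0n !mulr1n !add0r !mul1r addr0.
rewrite /slope (negPf n0) (negPf n10) add0r [1 == _]eq_sym invr_eq1 (negPf n1).
by rewrite mulr0.
Qed.

(** No slope vanishes, so only the means contribute, and the hypothesis cancels those of all cosets
    besides [k = 0] and [k = 1]. *)
Lemma fourier_teich0 m : w 1 + w 2 = 0 ->
  hat (teich_pair 0 m) =
  w 0 - w 5 + #|K|%:R * ((w 5 + w 6) / 2 + chi m * ((w 3 + w 4) / 2)).
Proof.
move=> w12; have n10 := oner_neq0 K.
have E k : psi (tau (0 * k)) * chi (m * k) * (mean_weight k *+ (0 == 0 :> K) +
    diff_weight k *+ (0 == slope k)) = chi (m * k) * mean_weight k.
  rewrite mul0r tau0 psi0 mul1r eqxx eq_sym (negPf (slope_neq0 k)).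
  by rewrite addr0.
rewrite fourier_color; under eq_bigr do rewrite E.
rewrite (bigD1 0) //= (bigD1 1) //= big1 => [|k /andP[n0 n1]].
  by rewrite /mean_weight !eqxx (negPf n10) !mulr0 mulr1 sign_tr0 mul1r addr0.
by rewrite /mean_weight (negPf n0) (negPf n1) w12 mul0r mulr0.
Qed.

End Weights.

(** * Weights with flat spectrum *)

Variable z : K.
Hypotheses (nz0 : z != 0) (nz1 : z != 1).

Definition hadamard_weights (w : 'I_7 -> C) (e1 e2 : C) :=
  [/\ w 0 = 1, w 1 = e1 * 'i, w 2 = - (e1 * 'i), w 5 = 1 &
   [/\ w 3 = e2 * 'i, w 4 = - (e2 * 'i) & w 6 = 1] \/
   [/\ w 3 = e2, w 4 = e2 & w 6 = -1]].

Lemma sqr_eqN1 (x : C) : x ^+ 2 = -1 -> exists2 e, e ^+ 2 = 1 & x = e * 'i.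
Proof.
move=> x2; exists (- (x * 'i)); last first.
  by rewrite mulNr -mulrA -expr2 sqrCi mulrN1 opprK.
by rewrite sqrrN exprMn x2 sqrCi mulrNN mulr1.
Qed.

(** Every coefficient is [#|K|] times a sign or times a sign and [psi 1 * 'i]; the latter product
    squares to 1 because both factors square to -1. *)
Lemma flat_hadamard_weights w e1 e2 : e1 ^+ 2 = 1 -> e2 ^+ 2 = 1 ->
  hadamard_weights w e1 e2 ->
  forall b, fourier psi (w \o ring_color) b ^+ 2 = #|R|%:R.
Proof.
move=> e11 e21 [w0 w1 w2 w5 H] b; rewrite card_galois_ring.
have p2 := psi1_sqr; have i2 := sqrCi C.
have n2 : 2 != 0 :> C by rewrite pnatr_eq0.
rewrite (teich_pairP b); move: (rho b) (snd_digit b) => l m {b}.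
have [->|l0] := eqVneq l 0.
  have c2 := sqr_sign_tr m.
  rewrite fourier_teich0 ?w1 ?w2 ?subrr // w0 w5 subrr.
  case: H => -[w3 w4 w6]; rewrite w3 w4 w6; first by field.
  transitivity (#|K|%:R ^+ 2 * (chi m ^+ 2 * e2 ^+ 2)); first by field.
  by rewrite c2 e21 !mulr1.
have [->|l1] := eqVneq l 1.
  have c2 := sqr_sign_tr m.
  rewrite fourier_teich1 w0 w5 subrr.
  case: H => -[w3 w4 w6]; rewrite w3 w4 w6; last by field.
  transitivity (#|K|%:R ^+ 2 * (psi 1 ^+ 2 * 'i ^+ 2 * (chi m ^+ 2 * e2 ^+ 2))).
    by field.
  by rewrite c2 e21 p2 i2; ring.
have c2 := sqr_sign_tr (m / l).
rewrite fourier_teich // w0 w5 w1 w2 subrr.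
transitivity
  (#|K|%:R ^+ 2 * (psi 1 ^+ 2 * 'i ^+ 2 * (chi (m / l) ^+ 2 * e1 ^+ 2))).
  by field.
by rewrite c2 e11 p2 i2; ring.
Qed.

(** The hypotheses on [w] are what modulus 1 and hermitian symmetry give: conjugate weights are
    mutually inverse and real weights are signs. The element [z] yields characters whose reduction
    avoids 0 and 1. *)
Lemma hadamard_weights_flat w :
  w 0 = 1 -> w 1 * w 2 = 1 -> w 3 * w 4 = 1 -> w 5 ^+ 2 = 1 -> w 6 ^+ 2 = 1 ->
  (forall b, fourier psi (w \o ring_color) b ^+ 2 = #|R|%:R) ->
  exists e1 e2, [/\ e1 ^+ 2 = 1, e2 ^+ 2 = 1 & hadamard_weights w e1 e2].
Proof.
move=> w0 w12 w34 w52 w62; rewrite card_galois_ring; set q := #|K|%:R => H.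
have p2 := psi1_sqr.
have n2 : 2 != 0 :> C by rewrite pnatr_eq0.
have q0 : q != 0 by rewrite pnatr_eq0 -lt0n; apply/card_gt0P; exists 0.
have p0 : psi 1 != 0 by rewrite -sqrf_eq0 p2 oppr_eq0 oner_eq0.
(* [K] contains 0, 1 and [z], so [q > 2]. *)
have q2 : q ^+ 2 != 2 ^+ 2.
  rewrite -!natrX eqr_nat eqn_exp2r // neq_ltn; apply/orP; right.
  rewrite (cardD1 0) (cardD1 1) (cardD1 z) !inE.
  by rewrite oner_neq0 nz0 nz1.
(* The second digits 0 and [z] realise both signs [chi (m / z)]. *)
have := H (teich_pair z 0); have := H (teich_pair z z).
rewrite !fourier_teich // mul0r divff // sign_tr0 sign_tr1 w0 -/q.
set B := (w 1 - w 2) / 2 => H1 H2.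
have w5 : w 5 = 1.
  move/eqP: w52; rewrite sqrf_eq1 => /orP[/eqP//|/eqP w5].
  move: H1 H2; rewrite w5 opprK => H1 H2.
  (* The squares of [2 + q * psi 1 * B] and [2 - q * psi 1 * B] agree, and they differ by
     [8 * q * psi 1 * B]. *)
  have B0 : B = 0.
    apply: (mulfI (x := 8 * q * psi 1)).
      by apply: mulf_neq0 p0; apply: mulf_neq0 q0; rewrite pnatr_eq0.
    by rewrite mulr0 -(subrr (q ^+ 2)) -{1}H2 -H1; ring.
  by move: H2; rewrite B0 mulr0 mulr0 addr0 => H2; rewrite -H2 eqxx in q2.
move: H2; rewrite w5 subrr add0r mulr1 => {}H2.
have B2 : B ^+ 2 = -1.
  apply: (mulfI (x := - q ^+ 2)); first by rewrite oppr_eq0 expf_neq0.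
  rewrite -[X in _ = - X * _]H2.
  by rewrite mulrN1 opprK !exprMn p2; ring.
(* The square of the sum is that of the difference, [4 * B ^+ 2 = -4], plus
   [4 * (w 1 * w 2) = 4]. *)
have w12s : w 1 + w 2 = 0.
  apply/eqP; rewrite -sqrf_eq0; apply/eqP.
  transitivity (4 * B ^+ 2 + 4 * (w 1 * w 2)); first by rewrite /B; field.
  by rewrite B2 w12; ring.
have w1B : w 1 = B.
  by rewrite /B -[w 2](addKr (w 1)) w12s; field.
have [e1 e12 Be] := sqr_eqN1 B2.
have w2B : w 2 = - (e1 * 'i).
  by rewrite -Be -w1B; apply/eqP; rewrite -addr_eq0 addrC w12s.
(* These two characters say that [(1 + w 6) / 2 + a] and [(1 + w 6) / 2 - a] both square to 1. This
   forces [a = 0] if [w 6 = 1], and [a ^+ 2 = 1] if [w 6 = -1]. *)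
have := H (teich_pair 0 0); have := H (teich_pair 0 1).
rewrite !fourier_teich0 // sign_tr0 sign_tr1 w0 w5 subrr !add0r -/q !exprMn.
set a := (w 3 + w 4) / 2.
have qI (x : C) : q ^+ 2 * x ^+ 2 = q ^+ 2 -> x ^+ 2 = 1.
  by rewrite -[X in _ = X]mulr1 => /mulfI; apply; rewrite expf_neq0.
move=> /qI H3 /qI H4; exists e1.
move/eqP: w62; rewrite sqrf_eq1 => /orP[] /eqP w6; rewrite w6 in H3 H4.
  have a0 : a = 0.
    apply: (mulfI (x := 4)); first by rewrite pnatr_eq0.
    transitivity (((1 + 1) / 2 + 1 * a) ^+ 2 - ((1 + 1) / 2 + -1 * a) ^+ 2).
      by field.
    by rewrite H4 H3 mulr0 subrr.
  have w43 : w 4 = - w 3.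
    by apply/eqP; rewrite -addr_eq0 addrC -[_ + _](divfK n2) -/a a0 mul0r.
  have [|e2 e22 w3] := @sqr_eqN1 (w 3).
    by rewrite -w34 w43; ring.
  exists e2; split=> //; split=> //; first by rewrite w1B.
  by left; rewrite w43 -w3.
have w43 : w 4 = w 3.
  apply/eqP; rewrite -subr_eq0 -sqrf_eq0; apply/eqP.
  transitivity (4 * (((1 - 1) / 2 + 1 * a) ^+ 2) - 4 * (w 3 * w 4)).
    by rewrite /a; field.
  by rewrite H4 w34 subrr.
exists (w 3); split=> //; first by rewrite -w34 w43.
split=> //; first by rewrite w1B.
by right.
Qed.

End TeichmullerCoordinates.

(** * The Galois ring and its reduction *)

Lemma Z4_to_F2_zmod_morphism : zmod_morphism Z4_to_F2.
Proof. by do 2![case=> [[|[|[|[|//]]]] ?]]; apply: val_inj. Qed.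

Lemma Z4_to_F2_monoid_morphism : monoid_morphism Z4_to_F2.
Proof. by split; [|do 2![case=> [[|[|[|[|//]]]] ?]]]; apply: val_inj. Qed.

HB.instance Definition _ :=
  GRing.isZmodMorphism.Build 'Z_4 'F_2 Z4_to_F2 Z4_to_F2_zmod_morphism.
HB.instance Definition _ :=
  GRing.isMonoidMorphism.Build 'Z_4 'F_2 Z4_to_F2 Z4_to_F2_monoid_morphism.

Lemma double_Z4_eq0 (a : 'Z_4) : (a *+ 2 == 0) = (Z4_to_F2 a == 0).
Proof. by case: a => [[|[|[|[|//]]]] ?]. Qed.

Definition half_Z4 (a : 'Z_4) : 'Z_4 := inZp (a./2).

Lemma half_Z4K (a : 'Z_4) : Z4_to_F2 a = 0 -> half_Z4 a *+ 2 = a.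
Proof.
by case: a => [[|[|[|[|//]]]] ?] /eqP // _; apply: val_inj.
Qed.

Section Instance.

Variables (e : nat) (phi : {poly 'F_2}) (phi_prim : primitive_poly phi).
Variable Phi : {poly 'Z_4}.
Hypothesis e_ge3 : (3 <= e)%N.
Hypothesis e_odd : odd e.
Hypothesis phi_deg : size phi = e.+1.
Hypothesis Phi_monic : Phi \is monic.
Hypothesis Phi_mod2 : map_poly Z4_to_F2 Phi = phi.
Hypothesis Phi_dvd : exists q : {poly 'Z_4}, 'X^(2 ^ e - 1) - 1 = q * Phi.

Local Notation K := {poly %/ phi with primitive_mi phi_prim}.
Local Notation GR := (galois_ring Phi).

Lemma size_phi_gt2 : (2 < size phi)%N.
Proof. by rewrite phi_deg ltnS (leq_trans _ e_ge3). Qed.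

Lemma size_Phi : size Phi = e.+1.
Proof.
rewrite -phi_deg -Phi_mod2 size_map_poly_id0 // (monicP Phi_monic) rmorph1.
exact: oner_neq0.
Qed.

(** The quotient is built on [mk_monic Phi], which falls back to a default modulus unless [Phi] is
    monic and nonconstant. *)
Lemma mk_monic_Phi : mk_monic Phi = Phi.
Proof. by rewrite /mk_monic size_Phi Phi_monic ltnS (leq_trans _ e_ge3). Qed.

Lemma size_galois_ring (a : GR) : (size (val a) <= e)%N.
Proof.
rewrite -ltnS; apply: leq_trans (size_mk_monic a) _.
by rewrite mk_monic_Phi size_Phi.
Qed.

Lemma coef_galois_ring (a : GR) i : (e <= i)%N -> (val a)`_i = 0.
Proof. by move=> ei; apply/nth_default/(leq_trans (size_galois_ring a)). Qed.

(** Reducing coefficients is compatible with division by [Phi], because [Phi] reduces to [phi],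
    which is 0 in [K]. *)
Lemma reduction_exists : exists rho : {rmorphism GR -> K},
  forall a : GR, rho a = in_qpoly phi (map_poly Z4_to_F2 (val a)).
Proof.
pose rho (a : GR) : K := in_qpoly phi (map_poly Z4_to_F2 (val a)).
have rhoB : zmod_morphism rho by move=> a b; rewrite /rho !raddfB.
have rho_in p : rho (in_qpoly Phi p) = in_qpoly phi (map_poly Z4_to_F2 p).
  rewrite /rho /= mk_monic_Phi [in RHS](Pdiv.RingMonic.rdivp_eq Phi_monic p).
  rewrite rmorphD rmorphM /= Phi_mod2 rmorphD rmorphM /=.
  have -> : in_qpoly phi phi = 0.
    by apply/eqP; rewrite (primitive_poly_in_qpoly_eq0 phi_prim).
  by rewrite mulr0 add0r.
have rhoM : monoid_morphism rho.
  split=> [|a b]; first by rewrite /rho /= rmorph1 in_qpoly1.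
  have -> : a * b = in_qpoly Phi (val a * val b) by [].
  by rewrite rho_in rmorphM in_qpolyM.
pose ra := GRing.isZmodMorphism.Build GR K rho rhoB.
pose rm := GRing.isMonoidMorphism.Build GR K rho rhoM.
pose r : {rmorphism GR -> K} := HB.pack rho ra rm.
by exists r.
Qed.

(** * Kernel of the reduction and the Teichmuller lift *)

Section Reduction.

Variable rho : {rmorphism GR -> K}.
Hypothesis rhoE :
  forall a : GR, rho a = in_qpoly phi (map_poly Z4_to_F2 (val a)).

(** The reduced polynomial has degree below that of [phi], so [phi] divides it only if it is 0. *)
Lemma reduction_eq0 (a : GR) :
  (rho a == 0) = [forall i : 'I_e, Z4_to_F2 (val a)`_i == 0].
Proof.
rewrite rhoE primitive_poly_in_qpoly_eq0 //.
have sa := size_galois_ring a.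
transitivity (map_poly Z4_to_F2 (val a) == 0).
  apply/idP/eqP => [dv|->]; last exact: dvdp0.
  apply: contraTeq dv => nz; apply/negP => /(dvdp_leq nz).
  by rewrite phi_deg leqNgt ltnS (leq_trans (size_poly _ _)).
apply/eqP/forallP => [a0 i|a0].
  by rewrite -[Z4_to_F2 _]coef_map a0 coef0.
apply/polyP => i; rewrite coef0 coef_map /=.
have [ie|ie] := ltnP i e; first exact/eqP/(a0 (Ordinal ie)).
by rewrite nth_default ?rmorph0 // (leq_trans sa).
Qed.

Lemma val_mul2 (a : GR) i : (val (2 * a))`_i = (val a)`_i *+ 2.
Proof. by rewrite mulr_natl raddfMn coefMn. Qed.

Lemma mul2_eq0_reduction (a : GR) : (2 * a == 0) = (rho a == 0).
Proof.
rewrite reduction_eq0; apply/eqP/forallP => [a0 i|a0].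
  by rewrite -double_Z4_eq0 -val_mul2 a0 coef0.
apply/val_inj/polyP => i; rewrite val_mul2 coef0.
have [ie|ie] := ltnP i e; last by rewrite coef_galois_ring // mul0rn.
by apply/eqP; rewrite double_Z4_eq0; apply: (a0 (Ordinal ie)).
Qed.

Lemma reduction_ker (a : GR) : rho a = 0 -> exists b, a = 2 * b.
Proof.
move/eqP; rewrite reduction_eq0 => /forallP a0.
exists (mk_npoly _ (fun i => half_Z4 (val a)`_i) : GR).
apply/val_inj/polyP => i; rewrite val_mul2 coef_poly.
have -> : (i < (size (mk_monic Phi)).-1)%N = (i < e)%N.
  by rewrite mk_monic_Phi size_Phi.
have [ie|ie] := ltnP i e; last by rewrite coef_galois_ring // mul0rn.
by rewrite half_Z4K //; apply/eqP/(a0 (Ordinal ie)).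
Qed.

Lemma reduction_xi : rho (xi Phi) = 'qX.
Proof.
rewrite rhoE (_ : val (xi Phi) = 'X) ?map_polyX //; apply: qpolyXE => //.
by rewrite size_Phi ltnS (leq_trans _ e_ge3).
Qed.

Lemma card_residue : #|K| = (2 ^ e)%N.
Proof. by rewrite card_qfpoly phi_deg card_Fp. Qed.

Lemma xi_order : xi Phi ^+ (#|K|.-1) = 1.
Proof.
have [q Phi_q] := Phi_dvd.
apply/eqP; rewrite -subr_eq0 card_residue -subn1.
have -> : xi Phi ^+ (2 ^ e - 1) - 1 = in_qpoly Phi ('X^(2 ^ e - 1) - 1).
  by rewrite rmorphB rmorphXn rmorph1.
rewrite Phi_q in_qpolyM.
have -> : in_qpoly Phi Phi = 0.
  by apply: val_inj; rewrite /= mk_monic_Phi Pdiv.RingMonic.rmodpp.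
by rewrite mulr0.
Qed.

(** [qlogp] is the discrete logarithm to base ['qX], so a power of [zeta] lifts to the same power of
    [xi]. *)
Definition teich_lift (k : K) : GR :=
  if k == 0 then 0 else xi Phi ^+ qlogp k.

Lemma teich_lift0 : teich_lift 0 = 0.
Proof. by rewrite /teich_lift eqxx. Qed.

Lemma teich_lift1 : teich_lift 1 = 1.
Proof. by rewrite /teich_lift oner_eq0 (qlogp1 size_phi_gt2). Qed.

(** Logarithms add modulo [#|K|.-1], and [xi_order] absorbs the wrap-around. *)
Lemma teich_liftM k l : teich_lift (k * l) = teich_lift k * teich_lift l.
Proof.
rewrite /teich_lift mulf_eq0.
have [_|k0] := eqVneq k 0; first by rewrite mul0r.
have [_|l0] := eqVneq l 0; first by rewrite mulr0.
by rewrite /= (qlogpD size_phi_gt2) // (expr_mod _ xi_order) exprD.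
Qed.

Lemma teich_liftK k : rho (teich_lift k) = k.
Proof.
rewrite /teich_lift; have [->|k0] := eqVneq k 0; first exact: rmorph0.
by rewrite rmorphXn /= reduction_xi (qlogp_qX size_phi_gt2).
Qed.

(** * The absolute trace and an additive character lifting it *)

Lemma dim_residue_field : \dim {:residue_field phi_prim} = e.
Proof.
have := card_vspace {:residue_field phi_prim}.
have -> : #|{:residue_field phi_prim}%VS| = (2 ^ e)%N.
  by rewrite -card_residue; apply: eq_card => x; rewrite memvf.
by rewrite card_Fp // => /eqP; rewrite eqn_exp2l // => /eqP.
Qed.

(** The trace takes only the values 0 and 1, so its non-vanishing determines it. *)
Definition trace_bit (k : K) : bool :=
  absolute_trace (k : residue_field phi_prim) != 0.

Lemma trace_bitE (k : K) :
  absolute_trace (k : residue_field phi_prim) = (trace_bit k)%:R.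
Proof.
have /vlineP[c] : absolute_trace (k : residue_field phi_prim) \in 1%VS.
  by apply: mem_galTrace; [apply/finField_galois/subvf | apply: memvf].
rewrite /trace_bit => ->.
have /orP[/eqP->|/eqP->] : (c == 0) || (c == 1) by case: c => [[|[|]]].
  by rewrite scale0r eqxx.
by rewrite scale1r oner_neq0.
Qed.

Lemma residue_add11 : 1 + 1 = 0 :> residue_field phi_prim.
Proof.
have -> : 1 = qpolyC phi 1 :> residue_field phi_prim by [].
rewrite -[LHS](qpolyCD phi 1 1) (_ : 1 + 1 = 0); last exact: val_inj.
exact: qpolyC0.
Qed.

Lemma trace_bitD k l : trace_bit (k + l) = trace_bit k (+) trace_bit l.
Proof.
have tD : absolute_trace (k + l : residue_field phi_prim) =
          absolute_trace (k : residue_field phi_prim)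
        + absolute_trace (l : residue_field phi_prim) by apply: raddfD.
rewrite {1}/trace_bit tD !trace_bitE.
by case: (trace_bit k); case: (trace_bit l);
  rewrite ?residue_add11 ?addr0 ?add0r ?eqxx ?oner_neq0.
Qed.

(** The trace of 1 counts the Galois group, whose order [e] is odd. *)
Lemma trace_bit1 : trace_bit 1.
Proof.
have dim_odd : #|'Gal({:residue_field phi_prim} / 1)%g| = e.
  rewrite -galois_dim ?dimv1 ?divn1 ?dim_residue_field //.
  exact/finField_galois/subvf.
rewrite /trace_bit /absolute_trace /galTrace.
under eq_bigr do rewrite rmorph1.
rewrite sumr_const dim_odd.
rewrite -(odd_double_half e) e_odd mulrnDr -muln2 mulnC mulrnA.
by rewrite [1 *+ 2]residue_add11 mul0rn addr0 oner_neq0.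
Qed.

(* A coefficientwise lift of the absolute trace to a [Z/4]-linear form; any
   such lift does, so the trace of the Galois ring is not needed. *)
Definition trace_form (a : GR) : 'Z_4 :=
  \sum_(i < e) (val a)`_i * (trace_bit ('qX ^+ i))%:R.

Lemma trace_formD a b : trace_form (a + b) = trace_form a + trace_form b.
Proof.
rewrite /trace_form -big_split /=; apply: eq_bigr => i _.
by rewrite coefD mulrDl.
Qed.

(** The trace is linear over ['F_2], so expanding the reduction in powers of ['qX] gives the form
    modulo 2. *)
Lemma trace_form_mod2 a : Z4_to_F2 (trace_form a) = (trace_bit (rho a))%:R.
Proof.
pose t (k : K) : 'F_2 := (trace_bit k)%:R.
have tD : {morph t : k l / k + l}.
  move=> k l; rewrite /t trace_bitD.
  by case: (trace_bit k); case: (trace_bit l); apply: val_inj.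
have t0 : t 0 = 0 by rewrite /t (tr0 trace_bitD).
have tZ c k : t (c *: k) = c * t k.
  have /orP[/eqP->|/eqP->] : (c == 0) || (c == 1) by case: c => [[|[|]]].
    by rewrite scale0r mul0r.
  by rewrite scale1r mul1r.
rewrite -[RHS]/(t (rho a)) rhoE.
have -> : map_poly Z4_to_F2 (val a) = \sum_(i < e) Z4_to_F2 (val a)`_i *: 'X^i.
  rewrite -(poly_def e (fun i => Z4_to_F2 (val a)`_i)).
  apply/polyP => i; rewrite coef_map coef_poly /=.
  by case: ltnP => // /coef_galois_ring ->; rewrite rmorph0.
rewrite linear_sum (big_morph t tD t0) rmorph_sum; apply: eq_bigr => i _.
by rewrite linearZ /= tZ rmorphXn rmorphM /= rmorph_nat.
Qed.

Definition trace_character (C : numClosedFieldType) (a : GR) : C :=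
  'i ^+ (trace_form a : nat).

Section Character.

Variable C : numClosedFieldType.
Local Notation psi := (@trace_character C).

Lemma trace_character0 : psi 0 = 1.
Proof.
rewrite /trace_character /trace_form big1 ?expr0 // => i _.
by rewrite coef0 mul0r.
Qed.

(** Exponents are representatives modulo 4, and ['i] has fourth power 1. *)
Lemma trace_characterD a b : psi (a + b) = psi a * psi b.
Proof.
rewrite /trace_character trace_formD -exprD expr_mod //.
by rewrite (exprM _ 2 2) sqrCi sqrrN expr1n.
Qed.

Lemma trace_character2 a : psi (2 * a) = sign_tr C trace_bit (rho a).
Proof.
rewrite mulr_natl mulr2n trace_characterD -expr2 /trace_character exprAC sqrCi.
rewrite -signr_odd /sign_tr; congr (_ ^+ nat_of_bool _).
have := trace_form_mod2 a.
by case: (trace_form a) => [[|[|[|[|//]]]] ?]; case: (trace_bit _).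
Qed.

End Character.

(** * The scheme classes in Teichmuller coordinates *)

Let tau2_eq0 := mul2_eq0_reduction.
Let ker := reduction_ker.
Local Notation tpair := (teich_pair teich_lift).

Let tpair_inj k s k' s' : tpair k s = tpair k' s' -> k = k' /\ s = s'.
Proof. exact: (teich_pair_inj tau2_eq0 teich_liftK trace_bitD trace_bit1). Qed.

Let tpairP a : a = tpair (rho a) (snd_digit rho teich_lift a).
Proof. exact: (teich_pairP ker tau2_eq0 teich_liftK). Qed.

Let tpair_opp k s : - tpair k s = tpair k (k + s).
Proof. exact: (opp_teich_pair tau2_eq0 teich_liftK trace_bitD trace_bit1). Qed.

Lemma tpair0 s : tpair 0 s = 2 * teich_lift s.
Proof. by rewrite /teich_pair teich_lift0 add0r. Qed.

Lemma tpair1 s : tpair 1 s = 1 + 2 * teich_lift s.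
Proof. by rewrite /teich_pair teich_lift1. Qed.

Lemma teich_lift_mul_pair l k s :
  teich_lift l * tpair k s = tpair (l * k) (l * s).
Proof. by rewrite /teich_pair !teich_liftM; ring. Qed.

Lemma teich_lift_exp j :
  (j < 2 ^ e - 1)%N -> xi Phi ^+ j = teich_lift ('qX ^+ j).
Proof.
move=> je; rewrite /teich_lift (negPf (qX_exp_neq0 size_phi_gt2 phi_prim j)).
by rewrite (qX_expK size_phi_gt2) // card_residue -subn1.
Qed.

Lemma qlogp_bound (k : K) : (qlogp k < 2 ^ e - 1)%N.
Proof. by have := qlogp_lt k; rewrite card_residue -subn1. Qed.

Lemma teichP t :
  reflect (exists2 k, k != 0 & t = teich_lift k) (t \in teich e Phi).
Proof.
apply: (iffP imsetP) => [[j _ ->]|[k k0 ->]].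
  exists ('qX ^+ (j : nat)); first exact: (qX_exp_neq0 size_phi_gt2).
  exact: teich_lift_exp.
by exists (Ordinal (qlogp_bound k)); rewrite // /teich_lift (negPf k0).
Qed.

Lemma teich0P t :
  reflect (exists k, [/\ k != 0, ~~ trace_bit k & t = teich_lift k])
          (t \in teich0 e phi_prim Phi).
Proof.
apply: (iffP imsetP) => [[j jt ->]|[k [k0 tk ->]]].
  exists ('qX ^+ (j : nat)); split; first exact: (qX_exp_neq0 size_phi_gt2).
    by move: jt; rewrite inE /trace_bit negbK.
  exact: teich_lift_exp.
exists (Ordinal (qlogp_bound k)); last by rewrite /= /teich_lift (negPf k0).
rewrite inE /=; move: tk; rewrite /trace_bit negbK.
by rewrite -[in X in X -> _](qlogp_qX size_phi_gt2 k0).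
Qed.

Lemma mem_maxideal k s : (tpair k s \in maxideal Phi) = (k == 0).
Proof.
apply/imsetP/eqP => [[b _]|->]; last first.
by exists (teich_lift s); rewrite // tpair0.
rewrite (tpairP b) (_ : 2 * _ = tpair 0 (rho b)); first by case/tpair_inj.
rewrite tpair0; apply: (mul2_rho tau2_eq0); rewrite teich_liftK.
by rewrite (rho_teich_pair teich_liftK trace_bitD trace_bit1).
Qed.

Lemma mem_maxideal0 k s :
  (tpair k s \in maxideal0 e phi_prim Phi) = (k == 0) && ~~ trace_bit s.
Proof.
rewrite !inE; apply/orP/andP =>
    [[/imsetP[_ /teich0P[l [l0 tl ->]]]|]|[/eqP-> ts]].
- by rewrite -tpair0 => /tpair_inj[-> ->].
- rewrite (_ : 0 = tpair 0 0); last by rewrite tpair0 teich_lift0 mulr0.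
  by move=> /eqP /tpair_inj[-> ->]; rewrite (tr0 trace_bitD).
rewrite tpair0; have [->|s0] := eqVneq s 0.
  by right; rewrite teich_lift0 mulr0.
by left; apply/imset_f/teich0P; exists s.
Qed.

Lemma mem_subgroupH k s :
  (tpair k s \in subgroupH e phi_prim Phi) = (k == 1) && ~~ trace_bit s.
Proof.
apply/imsetP/andP => [[p]|[/eqP-> ts]].
  rewrite (tpairP p) mem_maxideal0 => /andP[/eqP-> tp].
  by rewrite tpair0 -tpair1 => /tpair_inj[-> ->].
exists (tpair 0 s); first by rewrite mem_maxideal0 eqxx.
by rewrite tpair1 tpair0.
Qed.

(** Negation adds [k = 1] to the second digit, which flips its trace because 1 has trace 1. *)
Lemma mem_opp_subgroupH k s :
  (tpair k s \in oppset (subgroupH e phi_prim Phi)) = (k == 1) && trace_bit s.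
Proof.
have -> : (tpair k s \in oppset (subgroupH e phi_prim Phi)) =
          (- tpair k s \in subgroupH e phi_prim Phi).
  apply/imsetP/idP => [[a Ha ->]|Ha]; first by rewrite opprK.
  by exists (- tpair k s); rewrite ?opprK.
rewrite tpair_opp mem_subgroupH; have [->|//] := eqVneq k 1.
by rewrite trace_bitD trace_bit1 negbK.
Qed.

(** As elements of [A] have first digit 1, the first digit of a product determines its Teichmuller
    factor, and dividing by it recovers the factor in [A]. *)
Lemma mem_mulset_teich (A : {set GR}) k s :
  (forall l m, tpair l m \in A -> l = 1) ->
  (tpair k s \in mulset (teich e Phi :\ 1) A) =
  [&& k != 0, k != 1 & tpair 1 (k^-1 * s) \in A].
Proof.
move=> A1; apply/imset2P/and3P => [[t a]|[k0 k1 Ha]].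
  rewrite !inE => /andP[t1 /teichP[l l0 tl]].
  rewrite (tpairP a); move: (rho a) (snd_digit _ _ a) => r m {a} Ha.
  have r1 := A1 _ _ Ha; rewrite r1 in Ha *.
  rewrite tl teich_lift_mul_pair => /tpair_inj[-> ->]; rewrite mulr1 mulKf //.
  by split=> //; apply: contraNneq t1 => l1; rewrite tl l1 teich_lift1.
exists (teich_lift k) (tpair 1 (k^-1 * s)) => //.
  rewrite !inE; apply/andP; split; last by apply/teichP; exists k.
  by apply: contraNneq k1; rewrite -teich_lift1 => /(can_inj teich_liftK) ->.
by rewrite teich_lift_mul_pair mulr1 mulrA divff // mul1r.
Qed.

(** The seven sets are the fibres of [ring_color]; this carries the spectral computation over to the
    scheme. *)
Lemma mem_scheme_set (j : 'I_7) a :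
  (a \in scheme_set e phi_prim Phi j) =
  (ring_color rho teich_lift trace_bit a == j).
Proof.
rewrite (tpairP a).
rewrite (ring_color_pair ker tau2_eq0 teich_liftK trace_bitD trace_bit1).
move: (rho a) (snd_digit _ _ a) => k s {a}.
have H1 l m : tpair l m \in subgroupH e phi_prim Phi -> l = 1.
  by rewrite mem_subgroupH => /andP[/eqP].
have H2 l m : tpair l m \in oppset (subgroupH e phi_prim Phi) -> l = 1.
  by rewrite mem_opp_subgroupH => /andP[/eqP].
have p0 : (tpair k s == 0) = (k == 0) && (s == 0).
  rewrite (_ : 0 = tpair 0 0); last by rewrite tpair0 teich_lift0 mulr0.
  by apply/eqP/andP => [/tpair_inj[-> ->]|[/eqP-> /eqP->]].
have t0 := tr0 trace_bitD.
have i01 : (0 == 1 :> K) = false by rewrite eq_sym oner_eq0.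
rewrite /color; case: j => [[|[|[|[|[|[|[|//]]]]]]] ?];
  rewrite /scheme_set (tnth_nth set0) /= ?(mem_mulset_teich _ _ H1)
    ?(mem_mulset_teich _ _ H2) ?in_setD1 ?in_setD ?in_set1
    ?mem_maxideal0 ?mem_maxideal ?mem_subgroupH ?mem_opp_subgroupH ?p0;
  (have [k0|k0] := eqVneq k 0;
   [have [s0|s0] := eqVneq s 0 | have [k1|k1] := eqVneq k 1]);
  rewrite ?k0 ?s0 ?k1 ?i01 ?t0 ?eqxx ?andbF //=; by case: (trace_bit _).
Qed.

(** * From matrices to weights and back *)

Section Hadamard.

Variable C : numClosedFieldType.
Local Notation cls := (ring_color rho teich_lift trace_bit).
Local Notation psi := (@trace_character C).
Local Notation A := (scheme_mx C e phi_prim Phi).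

Lemma sum_scheme_mx (w : 'I_7 -> C) :
  \sum_(j < 7) w j *: A j = cayley_mx (w \o cls).
Proof.
apply/matrixP => i j; rewrite summxE !mxE /=.
set c := cls _; rewrite (bigD1 c) //= big1 ?addr0 => [|k /negPf kc].
  by rewrite !mxE inE /= mem_scheme_set eqxx mulr1.
by rewrite !mxE inE /= mem_scheme_set eq_sym kc mulr0.
Qed.

Let cls_tpair k s : cls (tpair k s) = color trace_bit k s.
Proof.
exact: (ring_color_pair ker tau2_eq0 teich_liftK trace_bitD trace_bit1).
Qed.

(** The order of ['qX] is [2 ^ e - 1 > 1]; this element later serves as [z]. *)
Lemma qX_neq1 : 'qX != 1 :> K.
Proof.
apply/eqP => q1; have : ('qX : K) ^+ 1 = 1 by rewrite expr1.
move=> /(qX_order_dvd size_phi_gt2) /dvdn_leq; rewrite card_residue => /(_ isT).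
apply/negP; rewrite -ltnNge -subn1 ltn_subRL.
by rewrite (leq_trans _ (leq_pexp2l _ e_ge3)).
Qed.

(** Hermitian symmetry conjugates the weight under negation, which swaps classes 1 and 2, swaps 3
    and 4, and fixes 5 and 6. One representative per class suffices. *)
Lemma hermitian_weights (w : 'I_7 -> C) :
  cayley_mx (w \o cls) \is hermsymmx ->
  [/\ w 2 = (w 1)^*, w 4 = (w 3)^*, w 5 = (w 5)^* & w 6 = (w 6)^*].
Proof.
move=> /is_hermitianmxP; rewrite expr0 scale1r => H.
have q0 := qX_neq0 size_phi_gt2 phi_prim; have q1 := qX_neq1.
have {}H a : w (cls (- a)) = (w (cls a))^*.
  move/matrixP/(_ (enum_rank 0) (enum_rank a)): H.
  by rewrite !mxE /= !enum_rankK sub0r subr0.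
have {}H k s : w (color trace_bit k (k + s)) = (w (color trace_bit k s))^*.
  by have := H (tpair k s); rewrite tpair_opp !cls_tpair.
have t0 := tr0 trace_bitD; have t1 := trace_bit1; have n10 := oner_eq0 K.
split.
- have := H 'qX 0; rewrite /color (negPf q0) (negPf q1) addr0 mulVf // mulr0.
  by rewrite t0 t1.
- by have := H 1 0; rewrite /color n10 eqxx addr0 t0 t1.
(* Class 5 needs a nonzero element of trace 0: since 1 has trace 1, either ['qX] or ['qX + 1] is
   one. *)
- have [z z0 tz] : exists2 z : K, z != 0 & ~~ trace_bit z.
    have [tq|tq] := boolP (trace_bit 'qX); last by exists 'qX.
    exists ('qX + 1); last by rewrite trace_bitD tq t1.
    by rewrite (addr_eq0_char2 trace_bitD t1).
  by have := H 0 z; rewrite /color eqxx add0r (negPf z0) (negPf tz).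
- by have := H 0 1; rewrite /color eqxx add0r n10 t1.
Qed.

Lemma hermitian_hadamard (w : 'I_7 -> C) :
  w 0 = 1 -> (forall j, j != 0 -> `|w j| = 1) ->
  let W := \sum_(j < 7) w j *: A j in
  W \is hermsymmx ->
  complex_hadamard W <->
  exists eps1 eps2 : C,
    [/\ eps1 = 1 \/ eps1 = -1, eps2 = 1 \/ eps2 = -1 &
        W = A 0 + (eps1 * 'i) *: (A 1 - A 2) + (eps2 * 'i) *: (A 3 - A 4)
            + A 5 + A 6
        \/
        W = A 0 + (eps1 * 'i) *: (A 1 - A 2) + eps2 *: (A 3 + A 4)
            + A 5 - A 6].
Proof.
move=> w0 wn; set W := \sum_(j < 7) _; move=> /= Wherm.
have pm (x : C) : x ^+ 2 = 1 <-> x = 1 \/ x = -1.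
  split=> [/eqP|[]->]; rewrite ?sqrrN ?expr1n //.
  by rewrite sqrf_eq1 => /orP[] /eqP; [left | right].
have nd := character_nondeg ker tau2_eq0 teich_liftK trace_bit1
  (@trace_character2 C).
have sqrP := cayley_sqr (trace_character0 C) (@trace_characterD C) nd.
have expand (v : 'I_7 -> C) : \sum_(j < 7) v j *: A j =
    v 0 *: A 0 + v 1 *: A 1 + v 2 *: A 2 + v 3 *: A 3 + v 4 *: A 4
    + v 5 *: A 5 + v 6 *: A 6.
  rewrite !big_ord_recr big_ord0 /= add0r.
  by do !congr (_ + _); congr (v _ *: A _); apply: val_inj.
have Wcay : W = cayley_mx (w \o cls) by apply: sum_scheme_mx.
(* The conjugate transpose is [W] itself, and the entries of [W] are weights, all of modulus 1. *)
have hadP : complex_hadamard W <-> W *m W = #|GR|%:R%:M.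
  have Wt : (W^t*)%sesqui = W.
    by move/is_hermitianmxP: Wherm; rewrite expr0 scale1r => <-.
  rewrite /complex_hadamard Wt; split=> [[]//|WW]; split=> // i j.
  by rewrite Wcay mxE /=; set c := cls _; have [->|/wn->] := eqVneq c 0;
    rewrite ?w0 ?normr1.
have weights_mx v e1 e2 : hadamard_weights v e1 e2 ->
    \sum_(j < 7) v j *: A j =
        A 0 + (e1 * 'i) *: (A 1 - A 2) + (e2 * 'i) *: (A 3 - A 4) + A 5 + A 6
    \/ \sum_(j < 7) v j *: A j =
        A 0 + (e1 * 'i) *: (A 1 - A 2) + e2 *: (A 3 + A 4) + A 5 - A 6.
  move=> [v0 v1 v2 v5 [][v3 v4 v6]]; [left|right];
  rewrite expand v0 v1 v2 v3 v4 v5 v6 !scale1r ?scaleNr ?scale1r.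
    by rewrite !scalerBr !addrA.
  by rewrite scalerBr scalerDr !addrA.
have flat v e1 e2 : e1 ^+ 2 = 1 -> e2 ^+ 2 = 1 -> hadamard_weights v e1 e2 ->
    W = \sum_(j < 7) v j *: A j -> complex_hadamard W.
  move=> e11 e21 vP Wv; apply/hadP; rewrite Wv sum_scheme_mx; apply/sqrP.
  exact: (flat_hadamard_weights ker tau2_eq0 teich_lift0 teich_lift1 teich_liftM
    teich_liftK trace_bitD trace_bit1 (trace_character0 C) (@trace_characterD C)
    (@trace_character2 C) e11 e21 vP).
split=> [/hadP|[e1 [e2 [/pm e11 /pm e21]]]].
  rewrite Wcay => /sqrP H.
  have wc j : j != 0 -> w j * (w j)^* = 1.
    by move=> /wn wj; rewrite -normCK wj expr1n.
  have [] := @hermitian_weights w; first by rewrite -Wcay.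
  move=> w2 w4 w5 w6.
  have [||||e1 [e2 [e11 e21 wP]]] :=
    hadamard_weights_flat ker tau2_eq0 teich_lift0 teich_lift1 teich_liftM
      teich_liftK trace_bitD trace_bit1 (trace_character0 C)
      (@trace_characterD C) (@trace_character2 C)
      (qX_neq0 size_phi_gt2 phi_prim) qX_neq1 w0 _ _ _ _ H.
  - by rewrite w2 wc.
  - by rewrite w4 wc.
  - by rewrite expr2 {2}w5 wc.
  - by rewrite expr2 {2}w6 wc.
  exists e1, e2; split; [exact/pm | exact/pm | ].
  by rewrite -Wcay; apply: weights_mx.
(* For the converse, weights are read off the given expression of [W], and [flat] is applied to them
   instead of [w]. *)
pose v s (x3 x4 x6 : C) : 'I_7 -> C := tnth [tuple 1; s; - s; x3; x4; 1; x6].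
have v_weights x3 x4 x6 : [/\ x3 = e2 * 'i, x4 = - (e2 * 'i) & x6 = 1] \/
   [/\ x3 = e2, x4 = e2 & x6 = -1] ->
   hadamard_weights (v (e1 * 'i) x3 x4 x6) e1 e2.
  by move=> xP; split; rewrite /v ?(tnth_nth 0).
case=> WE.
  pose u := v (e1 * 'i) (e2 * 'i) (- (e2 * 'i)) 1.
  have uP : hadamard_weights u e1 e2 by apply: v_weights; left.
  apply: (flat u e1 e2 e11 e21 uP).
  rewrite WE expand /u /v !(tnth_nth 0) /= !scale1r !scaleNr.
  by rewrite !scalerBr !addrA.
pose u := v (e1 * 'i) e2 e2 (-1).
have uP : hadamard_weights u e1 e2 by apply: v_weights; right.
apply: (flat u e1 e2 e11 e21 uP).
rewrite WE expand /u /v !(tnth_nth 0) /= !scale1r !scaleNr scale1r.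
by rewrite scalerBr scalerDr !addrA.
Qed.

End Hadamard.

End Reduction.
End Instance.

Theorem theorem5p1 (e : nat) (e_ge3 : (3 <= e)%N) (e_odd : odd e)
    (phi : {poly 'F_2}) (phi_prim : primitive_poly phi)
    (phi_deg : size phi = e.+1)
    (Phi : {poly 'Z_4}) (Phi_monic : Phi \is monic)
    (Phi_mod2 : map_poly Z4_to_F2 Phi = phi)
    (Phi_dvd : exists q : {poly 'Z_4}, 'X^(2 ^ e - 1) - 1 = q * Phi)
    (R : realType) (w : 'I_7 -> R[i])
    (w0 : w 0 = 1) (w_norm : forall j : 'I_7, j != 0 -> `|w j| = 1) :
  let A := scheme_mx R[i] e phi_prim Phi in
  let W := \sum_(j < 7) w j *: A j in
  W \is hermsymmx ->
  complex_hadamard W <->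
  exists eps1 eps2 : R[i],
    [/\ eps1 = 1 \/ eps1 = -1, eps2 = 1 \/ eps2 = -1 &
        W = A 0 + (eps1 * 'i) *: (A 1 - A 2) + (eps2 * 'i) *: (A 3 - A 4)
            + A 5 + A 6
        \/
        W = A 0 + (eps1 * 'i) *: (A 1 - A 2) + eps2 *: (A 3 + A 4)
            + A 5 - A 6].
Proof.
move=> A W.
have [rho rhoE] :=
  reduction_exists phi_prim e_ge3 phi_deg Phi_monic Phi_mod2.
exact: (hermitian_hadamard e_ge3 e_odd phi_deg Phi_monic Phi_mod2 Phi_dvd rhoE).
Qed.
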